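(* Let $n\in\mathbb N_0$, $\xi\in\partial\mathbb D$ and $\lambda\in\mathbb C$. If $\lambda\ne-\frac14$ and $s=s(\lambda)$, then the kernel $$ P_n(z,\xi\,|\,\lambda)=\frac{1}{n!\,(2s)^n}\bigl(-\mathfrak h(z,\xi)\bigr)^n\,P(z,\xi)^{s+1/2} $$ satisfies $$ (\mathfrak L-\lambda I)^nP_n(z,\xi\,|\,\lambda)=P(z,\xi\,|\,\lambda)\qquad(z\in\mathbb D), $$ where $\mathfrak L$ acts in the variable $z$. If $\lambda=-\frac14$ (where $s(\lambda)=0$), the same identity holds for $$ P_n(z,\xi\,|-\tfrac14)=\frac{1}{(2n)!}\,\mathfrak h(z,\xi)^{2n}\,P(z,\xi)^{1/2}. $$
   Context: $\mathbb D=\{z=x+iy\in\mathbb C:|z|<1\}$ is the open unit disk, $\partial\mathbb D$ the unit circle. The hyperbolic Laplacian is $\mathfrak L=\frac{(1-|z|^2)^2}{4}(\partial_x^2+\partial_y^2)$; $I$ is the identity operator. The Poisson kernel is $P(z,\xi)=\frac{1-|z|^2}{|\xi-z|^2}$ and the Busemann function is $\mathfrak h(z,\xi)=-\log P(z,\xi)$ ($z\in\mathbb D$, $\xi\in\partial\mathbb D$). For $\lambda\in\mathbb C$, $s(\lambda)=\sqrt{\lambda+\frac14}$, where the square root of $re^{i\phi}$ ($r\ge0$, $\phi\in(-\pi,\pi]$) is $\sqrt r\,e^{i\phi/2}$. One writes $P(z,\xi\,|\,\lambda)=P(z,\xi)^{s(\lambda)+1/2}$. *)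

(* Defs.v *)
From Stdlib Require Import Reals Factorial Lra.
From Coquelicot Require Import Coquelicot.
Open Scope R_scope.
Open Scope C_scope.

Definition Cexp (z : C) : C :=
  RtoC (exp (Re z)) * (cos (Im z), sin (Im z)).

(* Argument in ]-PI, PI]; Carg 0 = acos 0 is irrelevant in Csqrt. *)
Definition Carg (z : C) : R :=
  if Rle_dec 0 (Im z) then acos (Re z / Cmod z) else (- acos (Re z / Cmod z))%R.

Definition Csqrt (z : C) : C :=
  RtoC (sqrt (Cmod z)) * Cexp (Ci * RtoC (Carg z / 2)).

(* x^a for x > 0 and a complex exponent *)
Definition RCpow (x : R) (a : C) : C := Cexp (a * RtoC (ln x)).

(* Coquelicot's Derive is only real-valued, so derivatives of a complex-valued
   function of z = x + iy are taken on its real and imaginary parts. *)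
Definition Cpartial (m k : nat) (f : C -> C) (z : C) : C :=
  (partial_derive m k (fun x y => Re (f (x, y))) (Re z) (Im z),
   partial_derive m k (fun x y => Im (f (x, y))) (Re z) (Im z)).

Definition hyp_laplacian (f : C -> C) (z : C) : C :=
  RtoC ((1 - Cmod z ^ 2) ^ 2 / 4) * (Cpartial 2 0 f z + Cpartial 0 2 f z).

Definition hyp_laplacian_sub (lambda : C) (f : C -> C) (z : C) : C :=
  hyp_laplacian f z - lambda * f z.

Definition Poisson (z xi : C) : R := ((1 - Cmod z ^ 2) / Cmod (xi - z) ^ 2)%R.

Definition Busemann (z xi : C) : R := (- ln (Poisson z xi))%R.

Definition spec_s (lambda : C) : C := Csqrt (lambda + / 4).

Definition gen_Poisson (lambda z xi : C) : C :=
  RCpow (Poisson z xi) (spec_s lambda + / 2).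

Definition poly_Poisson (n : nat) (lambda z xi : C) : C :=
  / (RtoC (INR (fact n)) * (2 * spec_s lambda) ^ n)
  * RtoC ((- Busemann z xi) ^ n)
  * RCpow (Poisson z xi) (spec_s lambda + / 2).

Definition poly_Poisson_crit (n : nat) (z xi : C) : C :=
  / RtoC (INR (fact (2 * n))) * RtoC (Busemann z xi ^ (2 * n))
  * RCpow (Poisson z xi) (/ 2).

Lemma Cexp_i (t : R) : Cexp (Ci * RtoC t) = (cos t, sin t).
Proof.
unfold Cexp, Ci, RtoC, Cmult, Re, Im; simpl.
replace (0 * t - 1 * 0)%R with 0%R by ring.
replace (0 * 0 + 1 * t)%R with t by ring.
rewrite exp_0; f_equal; ring.
Qed.

Lemma Carg_polar (r phi : R) :
  (0 < r)%R -> (- PI < phi <= PI)%R ->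
  Carg (RtoC r * Cexp (Ci * RtoC phi)) = phi.
Proof.
intros Hr [H1 H2]; rewrite Cexp_i; unfold Carg.
assert (Hm : Cmod (RtoC r * (cos phi, sin phi)) = r).
{ rewrite Cmod_mult, Cmod_R, Rabs_pos_eq by lra.
  unfold Cmod; simpl fst; simpl snd.
  replace (cos phi ^ 2 + sin phi ^ 2)%R with 1%R.
  - rewrite sqrt_1; ring.
  - generalize (sin2_cos2 phi); unfold Rsqr; intros E; rewrite <- E; ring. }
rewrite Hm.
replace (Re (RtoC r * (cos phi, sin phi))) with (r * cos phi)%R
  by (unfold Re, RtoC, Cmult; simpl; ring).
replace (Im (RtoC r * (cos phi, sin phi))) with (r * sin phi)%R
  by (unfold Im, RtoC, Cmult; simpl; ring).
replace (r * cos phi / r)%R with (cos phi) by (field; lra).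
destruct (Rle_dec 0 (r * sin phi)) as [Hs|Hs].
- destruct (Rle_lt_dec 0 phi) as [Hp|Hp].
  + apply acos_cos; lra.
  + assert (0 < sin (- phi))%R by (apply sin_gt_0; lra).
    rewrite sin_neg in *; exfalso; nra.
- destruct (Rle_lt_dec 0 phi) as [Hp|Hp].
  + assert (0 <= sin phi)%R by (apply sin_ge_0; lra).
    exfalso; nra.
  + rewrite <- (cos_neg phi), acos_cos; lra.
Qed.

Lemma Csqrt_polar (r phi : R) :
  (0 <= r)%R -> (- PI < phi <= PI)%R ->
  Csqrt (RtoC r * Cexp (Ci * RtoC phi))
  = RtoC (sqrt r) * Cexp (Ci * RtoC (phi / 2)).
Proof.
intros [Hr|<-] Hphi; unfold Csqrt.
- rewrite (Carg_polar r phi Hr Hphi), Cmod_mult, Cmod_R, Rabs_pos_eq by lra.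
  rewrite Cexp_i; unfold Cmod at 1; simpl fst; simpl snd.
  replace (cos phi ^ 2 + sin phi ^ 2)%R with 1%R.
  + rewrite sqrt_1, Rmult_1_r; reflexivity.
  + generalize (sin2_cos2 phi); unfold Rsqr; intros E; rewrite <- E; ring.
- rewrite Cmult_0_l, Cmod_0, sqrt_0, !Cmult_0_l; reflexivity.
Qed.

(* Main.v *)
(* Put T = ln P = -h. Since w |grad T|^2 = 1 and w Delta T = -1 with
   w = (1 - |z|^2)^2 / 4, the operator L sends F(T) to F''(T) - F'(T). Hence, for
   a = s + 1/2, L - lambda sends p(T) e^{aT} to (p'' + 2 s p')(T) e^{aT}.
   If p^(n) is a constant d, then p'' + 2 s p' has (n-1)-th derivative 2 s d, so n
   steps lead to the constant (2s)^n d; for s = 0 each step is p |-> p''. *)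
Require Import Defs.
From Stdlib Require Import Reals Factorial Lra Lia.
From Coquelicot Require Import Coquelicot.
Open Scope R_scope.
Open Scope C_scope.

(** * Modulus, polar form and principal square root *)

Lemma Cmod_sqr (z : C) : (Cmod z ^ 2 = Re z ^ 2 + Im z ^ 2)%R.
Proof.
unfold Cmod; rewrite pow2_sqrt; [reflexivity | nra].
Qed.

Lemma Cmod_lt_1 (z : C) : (Cmod z < 1)%R <-> (Re z ^ 2 + Im z ^ 2 < 1)%R.
Proof.
rewrite <- Cmod_sqr; pose proof (Cmod_ge_0 z); split; intros; nra.
Qed.

Lemma Cexp_add (z w : C) : Cexp (z + w) = Cexp z * Cexp w.
Proof.
destruct z as [x y], w as [u v]; unfold Cexp; simpl.
rewrite exp_plus, cos_plus, sin_plus.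
unfold RtoC, Cmult; simpl; f_equal; ring.
Qed.

(** Since [sin (acos c)] is [sqrt (1 - c^2)], the polar form recovers the imaginary part up to sign;
    the case split in [Carg] on the sign of [Im z] selects the right one. *)
Lemma Cmod_Carg (z : C) : z <> 0 -> RtoC (Cmod z) * Cexp (Ci * RtoC (Carg z)) = z.
Proof.
intros Hz; pose proof (Cmod_gt_0 z) as [Hm _]; specialize (Hm Hz).
pose proof (Cmod_sqr z) as Hq.
set (c := (Re z / Cmod z)%R).
assert (Hc : (c * Cmod z = Re z)%R) by (unfold c; field; lra).
assert (Hq' : ((1 - c ^ 2) * Cmod z ^ 2 = Im z ^ 2)%R)
  by (pose proof (f_equal (fun x => x ^ 2)%R Hc) as E; cbv beta in E; lra).
assert (Hc0 : (0 <= 1 - c ^ 2)%R).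
{ apply (Rmult_le_reg_r (Cmod z ^ 2)); [now apply pow_lt |].
  rewrite Hq', Rmult_0_l; apply pow2_ge_0. }
assert (Hc1 : (-1 <= c <= 1)%R) by (split; nra).
(* The left side is the sine of [acos c] times the modulus; [Hq'] is the square of this identity. *)
assert (Hs : (sqrt (1 - c²) * Cmod z = Rabs (Im z))%R).
{ rewrite <- (sqrt_Rsqr (Cmod z)) by lra.
  rewrite <- sqrt_mult by (unfold Rsqr; nra).
  rewrite <- sqrt_Rsqr_abs; f_equal; unfold Rsqr; lra. }
rewrite Cexp_i; unfold Carg; fold c.
destruct (Rle_dec 0 (Im z)) as [Hi|Hi].
- rewrite cos_acos, sin_acos by exact Hc1.
  rewrite Rabs_pos_eq in Hs by exact Hi.
  apply injective_projections; unfold Re, Im in *; simpl; lra.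
- rewrite cos_neg, sin_neg, cos_acos, sin_acos by exact Hc1.
  rewrite Rabs_left in Hs by lra.
  apply injective_projections; unfold Re, Im in *; simpl; lra.
Qed.

(** Supplies [s * s = lambda + / 4] for [s = spec_s lambda]. The two half arguments add up to
    [Carg z]; zero is treated apart because the polar form requires [z <> 0]. *)
Lemma Csqrt_mul_self (z : C) : Csqrt z * Csqrt z = z.
Proof.
destruct (Ceq_dec z 0) as [->|Hz].
- unfold Csqrt; rewrite Cmod_0, sqrt_0; ring.
- rewrite <- (Cmod_Carg z Hz) at 3; unfold Csqrt.
  set (e := Cexp _).
  replace (RtoC (sqrt (Cmod z)) * e * (RtoC (sqrt (Cmod z)) * e))
    with (RtoC (sqrt (Cmod z)) * RtoC (sqrt (Cmod z)) * (e * e)) by ring.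
  rewrite <- RtoC_mult, sqrt_sqrt by apply Cmod_ge_0.
  unfold e; rewrite <- Cexp_add; f_equal; f_equal.
  rewrite <- Cmult_plus_distr_l, <- RtoC_plus; do 2 f_equal; lra.
Qed.

(** * Complex-valued functions of a real variable *)

(** Componentwise, as in [Cpartial], so that real and imaginary parts can be handed separately to
    lemmas on real functions. *)
Definition Cis_derive (f f' : R -> C) : Prop :=
  forall t, is_derive (fun x => Re (f x)) t (Re (f' t))
         /\ is_derive (fun x => Im (f x)) t (Im (f' t)).

Lemma Cis_derive_const (c : C) : Cis_derive (fun _ => c) (fun _ => 0).
Proof.
intros t; split; apply is_derive_Reals, derivable_pt_lim_const.
Qed.

Lemma Cis_derive_ext (f g f' g' : R -> C) :
  (forall t, f t = g t) -> (forall t, f' t = g' t) ->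
  Cis_derive f f' -> Cis_derive g g'.
Proof.
intros E E' H t; destruct (H t) as [H1 H2]; rewrite <- E'; split.
- eapply is_derive_ext; [| exact H1]; intros; cbv beta; now rewrite E.
- eapply is_derive_ext; [| exact H2]; intros; cbv beta; now rewrite E.
Qed.

Lemma Cis_derive_plus (f g f' g' : R -> C) :
  Cis_derive f f' -> Cis_derive g g' ->
  Cis_derive (fun t => f t + g t) (fun t => f' t + g' t).
Proof.
intros Hf Hg t; destruct (Hf t), (Hg t); split;
  apply (is_derive_plus (K := R_AbsRing) (V := R_NormedModule)); assumption.
Qed.

Lemma Cis_derive_mult (f g f' g' : R -> C) :
  Cis_derive f f' -> Cis_derive g g' ->
  Cis_derive (fun t => f t * g t) (fun t => f' t * g t + f t * g' t).
Proof.
intros Hf Hg t; destruct (Hf t) as [F1 F2], (Hg t) as [G1 G2]; split.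
- apply (is_derive_ext (fun x => Re (f x) * Re (g x) - Im (f x) * Im (g x))%R);
    [reflexivity |].
  replace (Re _) with ((Re (f' t) * Re (g t) + Re (f t) * Re (g' t))
     - (Im (f' t) * Im (g t) + Im (f t) * Im (g' t)))%R
    by (unfold Re, Im; simpl; ring).
  apply (is_derive_minus (K := R_AbsRing) (V := R_NormedModule));
    apply (is_derive_mult (K := R_AbsRing)); auto; exact Rmult_comm.
- apply (is_derive_ext (fun x => Re (f x) * Im (g x) + Im (f x) * Re (g x))%R);
    [reflexivity |].
  replace (Im _) with ((Re (f' t) * Im (g t) + Re (f t) * Im (g' t))
     + (Im (f' t) * Re (g t) + Im (f t) * Re (g' t)))%R
    by (unfold Re, Im; simpl; ring).
  apply (is_derive_plus (K := R_AbsRing) (V := R_NormedModule));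
    apply (is_derive_mult (K := R_AbsRing)); auto; exact Rmult_comm.
Qed.

Lemma Cis_derive_scal (c : C) (f f' : R -> C) :
  Cis_derive f f' -> Cis_derive (fun t => c * f t) (fun t => c * f' t).
Proof.
intros H; eapply Cis_derive_ext;
  [| | exact (Cis_derive_mult _ _ _ _ (Cis_derive_const c) H)];
  intros; cbv beta; ring.
Qed.

Lemma Cis_derive_Cexp (a : C) :
  Cis_derive (fun t => Cexp (a * RtoC t)) (fun t => a * Cexp (a * RtoC t)).
Proof.
destruct a as [u v]; intros t; unfold Cexp, Re, Im; simpl; split;
  auto_derive; trivial; unfold Rminus; ring.
Qed.

Lemma Cis_derive_pow (n : nat) :
  Cis_derive (fun t => RtoC (t ^ S n)) (fun t => RtoC (INR (S n)) * RtoC (t ^ n)).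
Proof.
intros t; rewrite <- RtoC_mult; split.
- change (is_derive (fun x => x ^ S n)%R t (INR (S n) * t ^ n)%R).
  apply is_derive_Reals, derivable_pt_lim_pow.
- apply is_derive_Reals, derivable_pt_lim_const.
Qed.

(** Describes polynomials of degree at most [n] through their [n]-th derivative alone: the iteration
    tracks the constant [d] and never the coefficients. *)
Fixpoint nth_derive_const (n : nat) (d : C) (p : R -> C) : Prop :=
  match n with
  | O => forall t, p t = d
  | S m => exists p', Cis_derive p p' /\ nth_derive_const m d p'
  end.

Lemma nth_derive_const_lin (n : nat) (a d e : C) (p q : R -> C) :
  nth_derive_const n d p -> nth_derive_const n e q ->
  nth_derive_const n (a * d + e) (fun t => a * p t + q t).
Proof.
revert p q; induction n as [|n IH]; simpl; intros p q.
- intros Hp Hq t; now rewrite Hp, Hq.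
- intros [p' [Hp Hp']] [q' [Hq Hq']]; exists (fun t => a * p' t + q' t); split.
  + apply Cis_derive_plus; [apply Cis_derive_scal |]; assumption.
  + apply IH; assumption.
Qed.

(** The constant reached after [n] derivatives can be differentiated once more, giving 0. This
    provides the second derivative that one application of the operator needs, and shows that it
    adds nothing to the constant. *)
Lemma nth_derive_const_derive (n : nat) (d : C) (p : R -> C) :
  nth_derive_const n d p -> exists p', Cis_derive p p' /\ nth_derive_const n 0 p'.
Proof.
revert p; induction n as [|n IH]; simpl; intros p.
- intros Hp; exists (fun _ => 0); split; [| trivial].
  eapply Cis_derive_ext; [| | exact (Cis_derive_const d)]; simpl; auto.
- intros [p' [Hp Hp']]; exists p'; split; [exact Hp | now apply IH].
Qed.

Lemma nth_derive_const_pow (n : nat) (c : C) :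
  nth_derive_const n (c * RtoC (INR (fact n))) (fun t => c * RtoC (t ^ n)).
Proof.
revert c; induction n as [|n IH]; intros c.
- intros t; reflexivity.
- exists (fun t => c * RtoC (INR (S n)) * RtoC (t ^ n)); split.
  + eapply Cis_derive_ext;
      [| | exact (Cis_derive_scal c _ _ (Cis_derive_pow n))];
      intros; cbv beta; ring.
  + change (fact (S n)) with (S n * fact n)%nat.
    rewrite mult_INR, RtoC_mult, Cmult_assoc; apply IH.
Qed.

(** * Second derivatives from local information *)

Lemma locally_disk_slice (x y : R) :
  (x ^ 2 + y ^ 2 < 1)%R -> locally x (fun t => (t ^ 2 + y ^ 2 < 1)%R).
Proof.
intros H.
assert (Hc : continuous (fun t => t ^ 2 + y ^ 2)%R x).
{ apply (ex_derive_continuous (K := R_AbsRing) (V := R_NormedModule)).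
  auto_derive; trivial. }
apply (Hc (fun u => u < 1)%R), (open_lt 1%R), H.
Qed.

(** Here [f1] need only be the derivative near [x], because the closed formulas for the derivatives
    of [ln P] are established only inside the disk. *)
Lemma Derive_2_loc (f f1 : R -> R) (x l : R) :
  locally x (fun t => is_derive f t (f1 t)) -> is_derive f1 x l ->
  Derive_n f 2 x = l.
Proof.
intros H1 H2; change (Derive (Derive f) x = l).
rewrite (Derive_ext_loc _ f1).
- now apply is_derive_unique.
- revert H1; apply filter_imp; intros t; apply is_derive_unique.
Qed.

(** * The function [ln P] in real coordinates, with [xi = a + ib] and [z = x + iy] *)

Definition log_Poisson (a b x y : R) : R :=
  ln ((1 - (x ^ 2 + y ^ 2)) / ((a - x) ^ 2 + (b - y) ^ 2)).

Definition log_Poisson_dx (a b x y : R) : R :=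
  (- 2 * x / (1 - (x ^ 2 + y ^ 2)) + 2 * (a - x) / ((a - x) ^ 2 + (b - y) ^ 2))%R.

Definition log_Poisson_dxx (a b x y : R) : R :=
  (- (2 * (1 - (x ^ 2 + y ^ 2)) + 4 * x ^ 2) / (1 - (x ^ 2 + y ^ 2)) ^ 2
   + (4 * (a - x) ^ 2 - 2 * ((a - x) ^ 2 + (b - y) ^ 2))
     / ((a - x) ^ 2 + (b - y) ^ 2) ^ 2)%R.

(** Reflection in the diagonal: derivatives in [y] follow from those in [x] with [a] and [b]
    exchanged. *)
Lemma log_Poisson_swap (a b x y : R) : log_Poisson a b x y = log_Poisson b a y x.
Proof.
unfold log_Poisson; do 2 f_equal; ring.
Qed.

Lemma ln_Poisson (z xi : C) :
  ln (Poisson z xi) = log_Poisson (Re xi) (Im xi) (Re z) (Im z).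
Proof.
unfold Poisson, log_Poisson; rewrite !Cmod_sqr; reflexivity.
Qed.

Section Slice.

Variables a b : R.
Hypothesis hab : (a ^ 2 + b ^ 2 = 1)%R.

Lemma dist_circle_pos (x y : R) :
  (x ^ 2 + y ^ 2 < 1)%R -> (0 < (a - x) ^ 2 + (b - y) ^ 2)%R.
Proof.
intros H.
pose proof (pow2_ge_0 (a - x)); pose proof (pow2_ge_0 (b - y)).
destruct (Req_dec ((a - x) ^ 2 + (b - y) ^ 2) 0) as [E|E]; [| lra].
assert (a - x = 0)%R by nra; assert (b - y = 0)%R by nra.
assert (a = x) by lra; assert (b = y) by lra; subst; lra.
Qed.

Lemma is_derive_log_Poisson (x y : R) :
  (x ^ 2 + y ^ 2 < 1)%R ->
  is_derive (fun t => log_Poisson a b t y) x (log_Poisson_dx a b x y).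
Proof.
intros H; pose proof (dist_circle_pos x y H) as HD.
unfold log_Poisson, log_Poisson_dx; auto_derive.
- repeat split.
  + intros E; apply (Rlt_not_eq _ _ HD); rewrite <- E; ring.
  + apply Rmult_lt_0_compat; [lra | apply Rinv_0_lt_compat]; nra.
- field; repeat split; nra.
Qed.

Lemma is_derive_log_Poisson_dx (x y : R) :
  (x ^ 2 + y ^ 2 < 1)%R ->
  is_derive (fun t => log_Poisson_dx a b t y) x (log_Poisson_dxx a b x y).
Proof.
intros H; pose proof (dist_circle_pos x y H) as HD.
unfold log_Poisson_dx, log_Poisson_dxx; auto_derive.
- repeat split; nra.
- field; repeat split; nra.
Qed.

Lemma Derive_2_comp_log_Poisson (g g1 g2 : R -> R) (x y : R) :
  (forall t, is_derive g t (g1 t)) -> (forall t, is_derive g1 t (g2 t)) ->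
  (x ^ 2 + y ^ 2 < 1)%R ->
  Derive_n (fun t => g (log_Poisson a b t y)) 2 x
  = (g2 (log_Poisson a b x y) * log_Poisson_dx a b x y ^ 2
     + g1 (log_Poisson a b x y) * log_Poisson_dxx a b x y)%R.
Proof.
intros H1 H2 H.
(* The first derivative is given by the chain rule; [is_derive_comp] puts the inner derivative in
   front, hence the order of the factors. *)
apply (Derive_2_loc _
  (fun t => log_Poisson_dx a b t y * g1 (log_Poisson a b t y))%R).
- generalize (locally_disk_slice x y H); apply filter_imp; intros t Ht.
  apply (is_derive_comp (K := R_AbsRing) (V := R_NormedModule)
    g (fun t => log_Poisson a b t y)); [apply H1 |].
  now apply is_derive_log_Poisson.
- replace (_ + _)%R with (log_Poisson_dxx a b x y * g1 (log_Poisson a b x y)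
    + log_Poisson_dx a b x y * (log_Poisson_dx a b x y * g2 (log_Poisson a b x y)))%R
    by ring.
  apply (is_derive_mult (K := R_AbsRing)
    (fun t => log_Poisson_dx a b t y) (fun t => g1 (log_Poisson a b t y))).
  + now apply is_derive_log_Poisson_dx.
  + apply (is_derive_comp (K := R_AbsRing) (V := R_NormedModule)
      g1 (fun t => log_Poisson a b t y)); [apply H2 |].
    now apply is_derive_log_Poisson.
  + exact Rmult_comm.
Qed.

(** With [N = 1 - |z|^2] and [D = |xi - z|^2], the weight cancels [N^2] and the claim becomes a
    polynomial identity with right side [D^2]. *)
Lemma log_Poisson_eikonal (x y : R) :
  (x ^ 2 + y ^ 2 < 1)%R ->
  ((1 - (x ^ 2 + y ^ 2)) ^ 2 / 4
   * (log_Poisson_dx a b x y ^ 2 + log_Poisson_dx b a y x ^ 2) = 1)%R.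
Proof.
intros H; pose proof (dist_circle_pos x y H) as HD.
unfold log_Poisson_dx.
replace (y ^ 2 + x ^ 2)%R with (x ^ 2 + y ^ 2)%R by ring.
replace ((b - y) ^ 2 + (a - x) ^ 2)%R with ((a - x) ^ 2 + (b - y) ^ 2)%R by ring.
set (D := ((a - x) ^ 2 + (b - y) ^ 2)%R) in *.
set (N := (1 - (x ^ 2 + y ^ 2))%R).
assert (HN : (0 < N)%R) by (unfold N; lra).
replace (N ^ 2 / 4 * _)%R
  with (((- x * D + (a - x) * N) ^ 2 + (- y * D + (b - y) * N) ^ 2) / D ^ 2)%R
  by (field; lra).
apply (Rmult_eq_reg_r (D ^ 2)); [| apply pow_nonzero; lra].
unfold Rdiv; rewrite Rmult_assoc, Rinv_l by (apply pow_nonzero; lra).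
assert (ED : D = (1 - 2 * a * x - 2 * b * y + (x ^ 2 + y ^ 2))%R)
  by (unfold D; rewrite <- hab; ring).
(* Expanding the squares, one factor [D] comes out. By [ED], which rests on [|xi| = 1], the inner
   bracket is again [D], and [|z|^2 + N = 1] leaves [D^2]. *)
replace (_ + _)%R
  with (D * ((x ^ 2 + y ^ 2) * D + N * (N - 2 * (x * (a - x) + y * (b - y)))))%R
  by (unfold D; ring).
replace (N - 2 * (x * (a - x) + y * (b - y)))%R with D by (rewrite ED; unfold N; ring).
unfold N; ring.
Qed.

(** The function [ln |xi - z|^2] is harmonic, so only [ln (1 - |z|^2)] contributes; its Euclidean
    Laplacian is [-4 / (1 - |z|^2)^2]. *)
Lemma log_Poisson_laplacian (x y : R) :
  (x ^ 2 + y ^ 2 < 1)%R ->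
  ((1 - (x ^ 2 + y ^ 2)) ^ 2 / 4
   * (log_Poisson_dxx a b x y + log_Poisson_dxx b a y x) = -1)%R.
Proof.
intros H; pose proof (dist_circle_pos x y H) as HD.
unfold log_Poisson_dxx; field; repeat split; nra.
Qed.

End Slice.

(** * The hyperbolic Laplacian on functions of [ln P] *)

Lemma RtoC_mult_pair (r : R) (w : C) : RtoC r * w = (r * Re w, r * Im w)%R.
Proof.
unfold RtoC, Cmult, Re, Im; simpl; f_equal; ring.
Qed.

Lemma hyp_laplacian_comp (xi : C) (F F1 F2 : R -> C) (z : C) :
  Cmod xi = 1%R -> Cis_derive F F1 -> Cis_derive F1 F2 -> (Cmod z < 1)%R ->
  hyp_laplacian (fun w => F (ln (Poisson w xi))) z
  = F2 (ln (Poisson z xi)) - F1 (ln (Poisson z xi)).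
Proof.
intros hxi H1 H2 Hz; apply Cmod_lt_1 in Hz.
assert (hab : (Re xi ^ 2 + Im xi ^ 2 = 1)%R) by (rewrite <- Cmod_sqr, hxi; ring).
assert (hba : (Im xi ^ 2 + Re xi ^ 2 = 1)%R) by (rewrite <- hab; ring).
(* The real-valued version, used below once for the real part of [F] and once for its imaginary
   part. *)
assert (key : forall g g1 g2 : R -> R,
  (forall t, is_derive g t (g1 t)) -> (forall t, is_derive g1 t (g2 t)) ->
  ((1 - Cmod z ^ 2) ^ 2 / 4
   * (partial_derive 2 0 (fun x y => g (ln (Poisson (x, y) xi))) (Re z) (Im z)
      + partial_derive 0 2 (fun x y => g (ln (Poisson (x, y) xi))) (Re z) (Im z))
   = g2 (ln (Poisson z xi)) - g1 (ln (Poisson z xi)))%R).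
{ intros g g1 g2 G1 G2; unfold partial_derive.
  change (Derive_n (fun x => Derive_n (fun y => g (ln (Poisson (x, y) xi))) 0 (Im z))
            2 (Re z))
    with (Derive_n (fun x => g (ln (Poisson (x, Im z) xi))) 2 (Re z)).
  change (Derive_n (fun x => Derive_n (fun y => g (ln (Poisson (x, y) xi))) 2 (Im z))
            0 (Re z))
    with (Derive_n (fun y => g (ln (Poisson (Re z, y) xi))) 2 (Im z)).
  rewrite (Derive_n_ext _ (fun x => g (log_Poisson (Re xi) (Im xi) x (Im z))))
    by (intros; now rewrite ln_Poisson).
  rewrite (Derive_n_ext (fun y => g (ln (Poisson (Re z, y) xi)))
             (fun y => g (log_Poisson (Im xi) (Re xi) y (Re z))))
    by (intros; now rewrite ln_Poisson, log_Poisson_swap).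
  rewrite (Derive_2_comp_log_Poisson _ _ hab g g1 g2) by assumption.
  rewrite (Derive_2_comp_log_Poisson _ _ hba g g1 g2) by (assumption || lra).
  rewrite (log_Poisson_swap (Im xi)), ln_Poisson, Cmod_sqr.
  pose proof (log_Poisson_eikonal _ _ hab _ _ Hz) as E.
  pose proof (log_Poisson_laplacian _ _ hab _ _ Hz) as L.
  set (t := log_Poisson _ _ _ _).
  (* The chain rule produces exactly this combination: the eikonal equation weighted by [g2 t] plus
     the Laplacian equation weighted by [g1 t]. *)
  pose proof (f_equal2 (fun u v => g2 t * u + g1 t * v)%R E L) as EL.
  cbv beta in EL; lra. }
pose proof (key (fun t => Re (F t)) (fun t => Re (F1 t)) (fun t => Re (F2 t))
  (fun t => proj1 (H1 t)) (fun t => proj1 (H2 t))) as K1.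
pose proof (key (fun t => Im (F t)) (fun t => Im (F1 t)) (fun t => Im (F2 t))
  (fun t => proj2 (H1 t)) (fun t => proj2 (H2 t))) as K2.
unfold hyp_laplacian; rewrite RtoC_mult_pair.
exact (f_equal2 pair K1 K2).
Qed.

(** Formulas for one application are proved only in the disk, so this is what allows the next one:
    the disk is open, hence functions agreeing there have the same partial derivatives there. *)
Lemma hyp_laplacian_sub_ext (lambda : C) (f g : C -> C) :
  (forall z, (Cmod z < 1)%R -> f z = g z) ->
  forall z, (Cmod z < 1)%R ->
  hyp_laplacian_sub lambda f z = hyp_laplacian_sub lambda g z.
Proof.
intros E z Hz; unfold hyp_laplacian_sub; rewrite (E z Hz); f_equal.
apply Cmod_lt_1 in Hz.
assert (E' : forall x y, (x ^ 2 + y ^ 2 < 1)%R -> f (x, y) = g (x, y))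
  by (intros; apply E, Cmod_lt_1; assumption).
assert (Hx := locally_disk_slice _ _ Hz).
assert (Hy : locally (Im z) (fun t => Re z ^ 2 + t ^ 2 < 1)%R).
{ rewrite Rplus_comm in Hz; generalize (locally_disk_slice _ _ Hz).
  apply filter_imp; intros; lra. }
unfold hyp_laplacian, Cpartial; do 2 f_equal; f_equal.
- apply (Derive_n_ext_loc (fun x => Re (f (x, Im z))) (fun x => Re (g (x, Im z))) 2).
  revert Hx; apply filter_imp; intros; now rewrite E'.
- apply (Derive_n_ext_loc (fun x => Im (f (x, Im z))) (fun x => Im (g (x, Im z))) 2).
  revert Hx; apply filter_imp; intros; now rewrite E'.
- apply (Derive_n_ext_loc (fun y => Re (f (Re z, y))) (fun y => Re (g (Re z, y))) 2).
  revert Hy; apply filter_imp; intros; now rewrite E'.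
- apply (Derive_n_ext_loc (fun y => Im (f (Re z, y))) (fun y => Im (g (Re z, y))) 2).
  revert Hy; apply filter_imp; intros; now rewrite E'.
Qed.

Lemma iter_hyp_laplacian_sub_ext (n : nat) (lambda : C) (f g : C -> C) :
  (forall z, (Cmod z < 1)%R -> f z = g z) ->
  forall z, (Cmod z < 1)%R ->
  Nat.iter n (hyp_laplacian_sub lambda) f z = Nat.iter n (hyp_laplacian_sub lambda) g z.
Proof.
intros E; induction n as [|n IH]; [exact E |].
now apply hyp_laplacian_sub_ext.
Qed.

(** * Iterates of the shifted operator on [p(ln P) P^(s + 1/2)] *)

Section Iterates.

Variables xi lambda s : C.
Hypothesis hxi : Cmod xi = 1%R.
Hypothesis hs : s * s = lambda + / 4.

Let polyexp (p : R -> C) (w : C) : C :=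
  p (ln (Poisson w xi)) * RCpow (Poisson w xi) (s + / 2).

(** With [a = s + 1/2], the coefficient of [p1] is [2a - 1 = 2s], and that of [p] is [a^2 - a -
    lambda = s^2 - 1/4 - lambda = 0]. *)
Lemma hyp_laplacian_sub_polyexp (p p1 p2 : R -> C) (z : C) :
  Cis_derive p p1 -> Cis_derive p1 p2 -> (Cmod z < 1)%R ->
  hyp_laplacian_sub lambda (polyexp p) z
  = polyexp (fun t => 2 * s * p1 t + p2 t) z.
Proof.
intros H1 H2 Hz; unfold hyp_laplacian_sub.
set (e := fun t => Cexp ((s + / 2) * RtoC t)).
assert (D0 := Cis_derive_Cexp (s + / 2)); fold e in D0.
assert (D1 := Cis_derive_mult _ _ _ _ H1 D0).
assert (D2 := Cis_derive_plus _ _ _ _ (Cis_derive_mult _ _ _ _ H2 D0)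
  (Cis_derive_mult _ _ _ _ H1 (Cis_derive_scal (s + / 2) _ _ D0))).
change (polyexp p) with (fun w => p (ln (Poisson w xi)) * e (ln (Poisson w xi))) at 1.
rewrite (hyp_laplacian_comp xi _ _ _ z hxi D1 D2 Hz).
unfold polyexp, RCpow; cbv beta; fold (e (ln (Poisson z xi))).
set (t := ln (Poisson z xi)).
replace lambda with (s * s - / 4) by (rewrite hs; ring).
field.
Qed.

Lemma iter_polyexp (n : nat) (d : C) (p : R -> C) :
  nth_derive_const n d p ->
  forall z, (Cmod z < 1)%R ->
  Nat.iter n (hyp_laplacian_sub lambda) (polyexp p) z
  = (2 * s) ^ n * d * RCpow (Poisson z xi) (s + / 2).
Proof.
revert d p; induction n as [|n IH]; intros d p.
- intros Hp z Hz; simpl; unfold polyexp; rewrite Hp; ring.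
- intros [p1 [Hp Hp1]] z Hz.
  destruct (nth_derive_const_derive _ _ _ Hp1) as [p2 [Hp1' Hp2]].
  (* The innermost operator is peeled off, since it is the one acting on an explicit [polyexp]; the
     outer [n] see its result only up to equality on the disk. *)
  rewrite Nat.iter_succ_r.
  rewrite (iter_hyp_laplacian_sub_ext n lambda _
             (polyexp (fun t => 2 * s * p1 t + p2 t)))
    by (try assumption; intros; now apply hyp_laplacian_sub_polyexp).
  rewrite (IH _ _ (nth_derive_const_lin n (2 * s) d 0 p1 p2 Hp1 Hp2) z Hz).
  simpl; ring.
Qed.

(** For [s = 0] the term in [p1] disappears, so each application consumes two derivatives and leaves
    [d] unscaled; hence [2 * n]. *)
Lemma iter_polyexp_crit (n : nat) (d : C) (p : R -> C) :
  s = 0 -> nth_derive_const (2 * n) d p ->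
  forall z, (Cmod z < 1)%R ->
  Nat.iter n (hyp_laplacian_sub lambda) (polyexp p) z
  = d * RCpow (Poisson z xi) (s + / 2).
Proof.
intros s0; revert p; induction n as [|n IH]; intros p.
- intros Hp z Hz; simpl; unfold polyexp; now rewrite Hp.
- replace (2 * S n)%nat with (S (S (2 * n))) by lia.
  intros [p1 [Hp [p2 [Hp1 Hp2]]]] z Hz.
  rewrite Nat.iter_succ_r.
  rewrite (iter_hyp_laplacian_sub_ext n lambda _ (polyexp p2)); [now apply IH | | exact Hz].
  intros w Hw; rewrite (hyp_laplacian_sub_polyexp p p1 p2 w Hp Hp1 Hw).
  unfold polyexp; f_equal; rewrite s0; ring.
Qed.

End Iterates.

(** * Normalising constants and the two spectral cases *)

Lemma RtoC_INR_fact_neq_0 (n : nat) : RtoC (INR (fact n)) <> 0.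
Proof.
intros E; exact (INR_fact_neq_0 n (f_equal fst E)).
Qed.

Theorem proposition2p6 (n : nat) (xi : C) (hxi : Cmod xi = 1%R) :
  (forall lambda : C, lambda <> - / 4 ->
   forall z : C, (Cmod z < 1)%R ->
   Nat.iter n (hyp_laplacian_sub lambda) (fun w => poly_Poisson n lambda w xi) z
   = gen_Poisson lambda z xi)
  /\
  (forall z : C, (Cmod z < 1)%R ->
   Nat.iter n (hyp_laplacian_sub (- / 4)) (fun w => poly_Poisson_crit n w xi) z
   = gen_Poisson (- / 4) z xi).
Proof.
split.
- intros lambda Hl z Hz.
  assert (hs : spec_s lambda * spec_s lambda = lambda + / 4)
    by apply Csqrt_mul_self.
  assert (s0 : spec_s lambda <> 0).
  { intros E; apply Hl; rewrite E in hs.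
    replace lambda with (lambda + / 4 - / 4) by ring; rewrite <- hs; ring. }
  assert (s2 : (2 * spec_s lambda) ^ n <> 0).
  { apply Cpow_nz, Cmult_neq_0; [| exact s0].
    intros E; apply (f_equal fst) in E; simpl in E; lra. }
  pose proof (RtoC_INR_fact_neq_0 n) as Hf.
  set (c := / (RtoC (INR (fact n)) * (2 * spec_s lambda) ^ n)).
  (* As [-h = ln P], the kernel is [p(ln P) P^(s + 1/2)] with [p(t) = c t^n]. *)
  rewrite (iter_hyp_laplacian_sub_ext n lambda _
    (fun w => c * RtoC (ln (Poisson w xi) ^ n)
              * RCpow (Poisson w xi) (spec_s lambda + / 2))).
  + etransitivity;
      [exact (iter_polyexp xi lambda (spec_s lambda) hxi hs n _ _
                (nth_derive_const_pow n c) z Hz) |].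
    (* The accumulated constant [(2s)^n * (c * n!)] equals 1 by the choice of [c]. *)
    unfold gen_Poisson, c; field; auto.
  + intros w _; unfold poly_Poisson, Busemann; now rewrite Ropp_involutive.
  + exact Hz.
- intros z Hz.
  (* The modulus factor [sqrt 0] annihilates the root, whatever value [Carg 0] takes. *)
  assert (s0 : spec_s (- / 4) = 0).
  { unfold spec_s, Csqrt; replace (- / 4 + / 4) with (RtoC 0) by ring.
    rewrite Cmod_0, sqrt_0; ring. }
  assert (hs : spec_s (- / 4) * spec_s (- / 4) = - / 4 + / 4)
    by (rewrite s0; ring).
  pose proof (RtoC_INR_fact_neq_0 (2 * n)) as Hf.
  set (c := / RtoC (INR (fact (2 * n)))).
  rewrite (iter_hyp_laplacian_sub_ext n (- / 4) _
    (fun w => c * RtoC (ln (Poisson w xi) ^ (2 * n))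
              * RCpow (Poisson w xi) (spec_s (- / 4) + / 2))).
  + etransitivity;
      [exact (iter_polyexp_crit xi (- / 4) (spec_s (- / 4)) hxi hs n _ _ s0
                (nth_derive_const_pow (2 * n) c) z Hz) |].
    unfold gen_Poisson, c; field; auto.
  + intros w _; unfold poly_Poisson_crit, Busemann; rewrite s0, Cplus_0_l.
    fold c; do 3 f_equal.
    (* The exponent is even, so the sign in [h = -ln P] vanishes after squaring. *)
    rewrite !pow_mult; f_equal; ring.
  + exact Hz.
Qed.
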